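(* Let $\varepsilon>0$. There exist constants $C_\varepsilon>0$ and $N_0$ (depending only on $\varepsilon$) such that for every integer $N\ge N_0$, if $\pi$ is a uniformly random $N\times N$ permutation matrix and $X_k := \sum_{i,j\in[N],\, i+j\le k}\pi_{ij}$, then \[ \mathbb{P}\!\left( \forall k \in [N+1],\ \left| X_k - \frac{k(k-1)}{2N} \right| < \varepsilon N \right) \ge 1 - C_\varepsilon \cdot \frac{\log N}{N \, \log \log N}. \]
   Context: $[n]=\{1,\ldots,n\}$. A permutation of $[N]$ is identified with its $N\times N$ permutation matrix $(\pi_{ij})$ (entries in $\{0,1\}$, exactly one $1$ in each row and each column), chosen uniformly among the $N!$ possibilities. *)

(* Defs.v *)
From HB Require Import structures.
From mathcomp Require Import all_boot all_order all_algebra all_fingroup.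
From mathcomp Require Import all_classical all_reals all_analysis.

Set Implicit Arguments.
Unset Strict Implicit.
Unset Printing Implicit Defensive.

Import Order.TTheory GRing.Theory Num.Theory.

Local Open Scope ring_scope.

Definition unif_prob (R : realType) (T : finType) (E : {set T}) : R :=
  #|E|%:R / #|T|%:R.

(* [perm_mx s i j] is 1 if [s i = j] and 0 otherwise.  The indices of ['I_N]
   start at 0, so [i.+1] and [j.+1] are the indices in {1, ..., N}. *)
Definition corner_sum (R : realType) (N : nat) (A : 'M[R]_N) (k : nat) : R :=
  \sum_(i < N) \sum_(j < N | (i.+1 + j.+1 <= k)%N) A i j.

Definition corner_close (R : realType) (N : nat) (eps : R) : {set 'S_N} :=
  [set s : 'S_N | [forall k : 'I_N.+2, (1 <= k)%N ==>
     (`|corner_sum (perm_mx s) k - (k%:R * (k%:R - 1)) / (2 * N%:R)|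
        < eps * N%:R)]]%SET.

(* Main.v *)
Require Import Defs.
From HB Require Import structures.
From mathcomp Require Import all_boot all_order all_algebra all_fingroup.
From mathcomp Require Import all_classical all_reals all_analysis.
From mathcomp Require Import ring lra zify.

(** For a set [A] of cells the number of ones of a uniformly random permutation
    matrix in [A] has mean [#|A| / N], and since two entries in distinct rows
    and columns are only slightly correlated, its variance is at most [3 N].
    Chebyshev's inequality then gives a deviation of order [eps N] with
    probability [O(1 / N)] for each fixed [k].  As [X_k] is
    monotone in [k] and its mean is 1-Lipschitz, it suffices to control a number
    of values of [k] that depends only on [eps]; and
    [1 / N <= ln N / (N ln ln N)]. *)

Set Implicit Arguments.
Unset Strict Implicit.

Import Order.TTheory GRing.Theory Num.Theory.
Local Open Scope ring_scope.

(** * Moments of the number of ones in a set of cells, as unnormalised sums over ['S_n] *)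

Section PermutationMoments.
Context {R : realFieldType} {n : nat}.
Implicit Types (i j : 'I_n) (s : 'S_n).

Lemma sum_ord_eq (k : 'I_n) : \sum_(j < n) (k == j)%:R = 1 :> R.
Proof.
rewrite (bigD1 k) //= eqxx big1 ?addr0 // => j /negPf.
by rewrite eq_sym => ->.
Qed.

(** Composing with [tperm j j'] permutes ['S_n] and moves column [j'] to [j], so all columns of row
    [i] share the same count; together these counts exhaust ['S_n]. *)
Lemma sum_perm_entry i j :
  n%:R * \sum_(s : 'S_n) (s i == j)%:R = #|'S_n|%:R :> R.
Proof.
have swap j' : \sum_(s : 'S_n) (s i == j')%:R
    = \sum_(s : 'S_n) (s i == j)%:R :> R.
  rewrite (reindex_inj (mulIg (tperm j j'))) /=.
  apply: eq_bigr => s _; rewrite permM.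
  by rewrite -{2}(tpermL j j') (inj_eq perm_inj).
have -> : n%:R * \sum_(s : 'S_n) (s i == j)%:R
    = \sum_(j' < n) \sum_(s : 'S_n) (s i == j')%:R :> R.
  rewrite [RHS](eq_bigr _ (fun j' _ => swap j')).
  by rewrite sumr_const card_ord mulr_natl.
rewrite exchange_big /=.
under eq_bigr => s _ do rewrite sum_ord_eq.
by rewrite sumr_const.
Qed.

(** The transposition of [j'] and [k] fixes [j], so the joint count is the same for each of the
    [n - 1] columns [k != j]. Summed over these [k], the second factor gives 1, because [s i = j]
    excludes [s i' = j]. *)
Lemma sum_perm_entry2 i i' j j' : i != i' -> j != j' ->
  (n%:R - 1) * \sum_(s : 'S_n) ((s i == j)%:R * (s i' == j')%:R)
    = \sum_(s : 'S_n) (s i == j)%:R :> R.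
Proof.
move=> ii' jj'.
have swap k : k != j -> \sum_(s : 'S_n) ((s i == j)%:R * (s i' == k)%:R)
    = \sum_(s : 'S_n) ((s i == j)%:R * (s i' == j')%:R) :> R.
  move=> kj; rewrite (reindex_inj (mulIg (tperm j' k))) /=.
  apply: eq_bigr => s _; rewrite !permM.
  have -> : (tperm j' k (s i') == k) = (s i' == j').
    by rewrite -{2}(tpermL j' k) (inj_eq perm_inj).
  have -> : (tperm j' k (s i) == j) = (s i == j).
    have tj : tperm j' k j = j by rewrite tpermD // eq_sym.
    by rewrite -{1}tj (inj_eq perm_inj).
  by [].
have n1 : n%:R - 1 = #|[pred k : 'I_n | k != j]|%:R :> R.
  have /(congr1 (fun k => k%:R : R)) := cardC (pred1 j).
  rewrite card1 card_ord natrD => <-.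
  by rewrite addrC addKr; congr (_%:R); apply: eq_card.
rewrite n1 mulr_natl -sumr_const.
under eq_bigr => k kj do rewrite -(swap k kj).
rewrite exchange_big /=; apply: eq_bigr => s _.
rewrite -mulr_sumr.
case: eqP => [sij|_]; last by rewrite mul0r.
rewrite mul1r; have := sum_ord_eq (s i'); rewrite (bigD1 j) //=.
by rewrite -{1}sij (inj_eq perm_inj) eq_sym (negPf ii') add0r.
Qed.

Lemma sum_perm_entry2_clash i j i' j' : (i == i') (+) (j == j') ->
  \sum_(s : 'S_n) ((s i == j)%:R * (s i' == j')%:R) = 0 :> R.
Proof.
move=> h; apply: big1 => s _; case: eqP => [sij|_]; last by rewrite mul0r.
case: eqP => [sj|_]; last by rewrite mulr0.
by move: h; rewrite -sij -sj (inj_eq perm_inj) addbb.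
Qed.

Definition perm_count (A : {set 'I_n * 'I_n}) (s : 'S_n) : R :=
  \sum_(p in A) (s p.1 == p.2)%:R.

Lemma perm_count_variance (A : {set 'I_n * 'I_n}) : (1 < n)%N ->
  \sum_(s : 'S_n) (perm_count A s - #|A|%:R / n%:R) ^+ 2
    <= 3 * n%:R * #|'S_n|%:R.
Proof.
move=> n1.
set M : R := #|'S_n|%:R; set a : R := #|A|%:R; set N : R := n%:R.
have M0 : 0 <= M by [].
have N2 : 2 <= N by rewrite ler_nat.
have N0 : N != 0 by apply: lt0r_neq0; lra.
have N10 : N - 1 != 0 by apply: lt0r_neq0; lra.
have a0 : 0 <= a by [].
have aN : a <= N ^+ 2.
  rewrite -natrX ler_nat; apply: leq_trans (max_card _) _.
  by rewrite card_prod card_ord mulnn.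
have sum_a x : \sum_(p in A) x = a * x :> R by rewrite sumr_const mulr_natl.
have entry p : \sum_(s : 'S_n) (s p.1 == p.2)%:R = M / N :> R.
  by rewrite /M -(sum_perm_entry p.1 p.2) -/N mulrAC divff ?mul1r.
have first : \sum_(s : 'S_n) perm_count A s = a * (M / N).
  by rewrite exchange_big /= -sum_a; apply: eq_bigr => p _; exact: entry.
(* One bound for all pairs: equal cells give [M / N], distinct cells sharing a row or column give 0,
   and all others give exactly [M / (N * (N - 1))]. *)
have entry2 p q : \sum_(s : 'S_n) ((s p.1 == p.2)%:R * (s q.1 == q.2)%:R)
    <= (p == q)%:R * (M / N) + M / (N * (N - 1)) :> R.
  have MN : 0 <= M / (N * (N - 1)).
    by apply: divr_ge0 => //; apply: mulr_ge0; lra.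
  have [<-|pq] := eqVneq p q.
    rewrite mul1r -(entry p) ler_wpDr //; apply: ler_sum => s _.
    by case: eqP => _; rewrite ?mulr1 ?mulr0.
  rewrite mul0r add0r; move: pq; case: p q => [i j] [i' j'] /=.
  rewrite xpair_eqE negb_and => h.
  have [e|ii'] := eqVneq i i'.
    by rewrite sum_perm_entry2_clash // e eqxx; move: h; rewrite e eqxx.
  have [e|jj'] := eqVneq j j'.
    by rewrite sum_perm_entry2_clash // (negPf ii') e eqxx.
  have := sum_perm_entry2 ii' jj'; rewrite (entry (i, j)) => e.
  by rewrite invfM mulrA -e -/N mulrAC divff ?mul1r.
have second : \sum_(s : 'S_n) perm_count A s ^+ 2
    <= a * (M / N) + a ^+ 2 * (M / (N * (N - 1))).
  under eq_bigr => s _ do rewrite expr2 /perm_count big_distrlr /=.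
  rewrite exchange_big /= expr2 -mulrA -mulrDr -sum_a; apply: ler_sum => p pA.
  rewrite exchange_big /=; apply: le_trans (ler_sum _ (fun q _ => entry2 p q)) _.
  rewrite big_split /= sum_a lerD2r (bigD1 p) //= eqxx mul1r big1 ?addr0 // => q.
  by case/andP=> _; rewrite eq_sym => /negPf ->; rewrite mul0r.
have -> : \sum_(s : 'S_n) (perm_count A s - a / N) ^+ 2
    = \sum_(s : 'S_n) perm_count A s ^+ 2 - M * (a / N) ^+ 2.
  under eq_bigr => s _ do rewrite sqrrB -mulrnAl.
  rewrite big_split sumrB /= -mulr_suml sumrMnl first sumr_const.
  by rewrite -[_ *+ #|_|]mulr_natl -/M; field.
(* The squared mean cancels the second moment up to [a ^+ 2 / (N ^+ 2 * (N - 1))]. In this form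
   [a <= N ^+ 2] and [N >= 2] bound the two summands by [N] and [2 * N], whence the constant 3. *)
apply: le_trans (_ : M * (a / N + (a / N ^+ 2) ^+ 2 * (N ^+ 2 / (N - 1))) <= _).
  rewrite lerBlDr; apply: le_trans second _.
  by rewrite le_eqVlt; apply/orP; left; apply/eqP; field; rewrite N0 N10.
rewrite mulrC ler_wpM2r //.
have N2_gt0 : 0 < N ^+ 2 by apply: exprn_gt0; lra.
have aN1 : a / N <= N by rewrite ler_pdivrMr -?expr2 //; lra.
have aN2 : (a / N ^+ 2) ^+ 2 <= 1.
  by rewrite expr_le1 ?ler_pdivrMr ?mul1r ?divr_ge0 // ltW.
have NN : N ^+ 2 / (N - 1) <= 2 * N by rewrite ler_pdivrMr; nra.
have : (a / N ^+ 2) ^+ 2 * (N ^+ 2 / (N - 1)) <= 1 * (2 * N).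
  by apply: ler_pM => //; [exact: sqr_ge0|apply: divr_ge0; lra].
lra.
Qed.

Lemma perm_count_chebyshev (A : {set 'I_n * 'I_n}) (t : R) :
  (1 < n)%N -> 0 <= t ->
  #|[set s : 'S_n | t <= `|perm_count A s - #|A|%:R / n%:R| ]%SET|%:R * t ^+ 2
    <= 3 * n%:R * #|'S_n|%:R.
Proof.
move=> n1 t0; apply: le_trans (perm_count_variance A n1).
rewrite mulr_natl -sumr_const.
rewrite [leRHS](bigID (fun s => t <= `|perm_count A s - #|A|%:R / n%:R|)) /=.
under eq_bigl => s do rewrite inE.
rewrite ler_wpDr ?sumr_ge0 // => [s _|]; first exact: sqr_ge0.
apply: ler_sum => s ts.
by rewrite -[leRHS]real_normK ?num_real // ler_sqr ?nnegrE.
Qed.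

End PermutationMoments.

(** * Size of the corners *)

Lemma sum_subn_ord m n : (m <= n)%N -> (2 * \sum_(i < n) (m - i) = m * m.+1)%N.
Proof.
elim: n m => [|n IH] m mn.
  by rewrite big_ord0; move: mn; rewrite leqn0 => /eqP ->.
rewrite big_ord_recl /= subn0 mulnDr.
have -> : (\sum_(i < n) (m - bump 0 i) = \sum_(i < n) (m.-1 - i))%N.
  by apply: eq_bigr => i _; rewrite /bump /=; lia.
by rewrite IH; [case: m mn => // m _ /=; lia|lia].
Qed.

Lemma card_ord_ltn n k : (k <= n)%N -> #|[pred j : 'I_n | (j < k)%N]| = k.
Proof.
move=> kn; rewrite -sum1_card (big_ord_narrow kn) /=.
by rewrite sum_nat_const card_ord muln1.
Qed.

Definition corner n k : {set 'I_n * 'I_n} :=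
  [set p : 'I_n * 'I_n | (p.1.+1 + p.2.+1 <= k)%N]%SET.

(** Row [i] holds [k.-1 - i] cells, with truncated subtraction for the empty rows; [k <= n.+1]
    ensures that no row is cut off by the edge of the matrix. *)
Lemma card_corner n k : (k <= n.+1)%N -> (2 * #|corner n k| = k * k.-1)%N.
Proof.
move=> kn; rewrite -sum1_card.
have -> : (\sum_(p in corner n k) 1
    = \sum_(i < n) \sum_(j < n | i.+1 + j.+1 <= k) 1)%N.
  by rewrite pair_big_dep /=; apply: eq_bigl => p; rewrite inE.
have -> : (\sum_(i < n) \sum_(j < n | i.+1 + j.+1 <= k) 1
    = \sum_(i < n) (k.-1 - i))%N.
  apply: eq_bigr => i _; rewrite sum1_card -[RHS](@card_ord_ltn n); last by lia.
  by apply: eq_card => j; rewrite !inE unfold_in /=; apply/idP/idP; lia.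
by rewrite sum_subn_ord; [case: k kn => // k _; rewrite mulnC|lia].
Qed.

(** * Corner sums and their means, on a grid and between grid points *)

Section CornerSum.
Context {R : realType}.

Lemma corner_mean n k : (k <= n.+1)%N ->
  #|corner n k|%:R / n%:R = k%:R * (k%:R - 1) / (2 * n%:R) :> R.
Proof.
move=> kn; have -> : k%:R * (k%:R - 1) = 2 * #|corner n k|%:R :> R.
  rewrite -natrM card_corner //; case: k {kn} => [|k]; rewrite ?mul0r ?mul0n //.
  by rewrite natrM /= -natr1 addrK.
by rewrite -mulf_div divff ?mul1r.
Qed.

Lemma corner_sum_perm n k (s : 'S_n) :
  corner_sum (perm_mx s) k = perm_count (corner n k) s :> R.
Proof.
rewrite /corner_sum /perm_count pair_big_dep /=.
by apply: eq_big => [p|p _]; rewrite ?inE // !mxE.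
Qed.

Lemma le_corner_sum n k l (s : 'S_n) : (k <= l)%N ->
  corner_sum (perm_mx s) k <= corner_sum (perm_mx s) l :> R.
Proof.
move=> kl; apply: ler_sum => i _.
rewrite big_mkcond [leRHS]big_mkcond /=; apply: ler_sum => j _.
rewrite !mxE; case: ifP => [ik|_]; first by rewrite (leq_trans ik kl).
by case: ifP.
Qed.

Lemma corner_mean_diff (n l u : nat) :
  (0 < n)%N -> (l <= u)%N -> (u <= n.+1)%N ->
  u%:R * (u%:R - 1) / (2 * n%:R) - l%:R * (l%:R - 1) / (2 * n%:R)
    <= u%:R - l%:R :> R.
Proof.
(* The difference is [(u - l) * (u + l - 1) / (2 * n)]. Strictness [l < u] gives
   [u + l <= 2 * n + 1], which fails at [l = u = n.+1]; hence the separate case. *)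
move=> n0; rewrite leq_eqVlt => /predU1P[->|lu] un; first by rewrite !subrr.
have n0R : 0 < 2 * n%:R :> R by rewrite mulr_gt0 ?ltr0n.
rewrite -mulrBl ler_pdivrMr //.
have : (u + l)%:R <= (n + n + 1)%:R :> R by rewrite ler_nat; lia.
have : l%:R <= u%:R :> R by rewrite ler_nat ltnW.
rewrite !natrD; nra.
Qed.

(* Monotonicity of the corner sums propagates closeness at the grid points
   [r * h] to every [k] in between. *)
Lemma corner_close_grid n h m (eps : R) (s : 'S_n) :
  (0 < n)%N -> (0 < h)%N -> (n.+1 <= m * h)%N -> h%:R <= eps / 2 * n%:R ->
  (forall r : 'I_m.+2, `|corner_sum (perm_mx s) (minn (r * h) n.+1)
     - #|corner n (minn (r * h) n.+1)|%:R / n%:R| < eps / 2 * n%:R) ->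
  s \in corner_close n eps.
Proof.
move=> n0 h0 nmh heps close; rewrite inE; apply/forallP => k; apply/implyP => k1.
have kn : (k <= n.+1)%N by rewrite -ltnS ltn_ord.
(* The upper neighbour has index [(k %/ h).+1], which can reach [m.+1]: this is why the grid is
   indexed by ['I_m.+2]. *)
have rm : (k %/ h <= m)%N by rewrite -(mulnK m h0) leq_div2r // (leq_trans kn).
have kl : ((k %/ h) * h <= k)%N := leq_divM k h.
have ku : (k < (k %/ h).+1 * h)%N by rewrite ltn_ceil.
have := close (@Ordinal m.+2 (k %/ h) (leqW rm)).
have := close (@Ordinal m.+2 (k %/ h).+1 rm).
rewrite /= (minn_idPl (leq_trans kl kn)).
set l := ((k %/ h) * h)%N in kl *; set u := minn _ _.
have un : (u <= n.+1)%N by rewrite geq_minr.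
have ku' : (k <= u)%N by rewrite leq_min (ltnW ku).
have ul : (u <= l + h)%N by rewrite /u /l -mulSnr geq_minl.
rewrite !corner_mean ?(leq_trans kl kn) //.
have := le_corner_sum s kl; have := le_corner_sum s ku'.
have := corner_mean_diff n0 ku' un; have := corner_mean_diff n0 kl kn.
have : u%:R <= l%:R + h%:R :> R by rewrite -natrD ler_nat.
have : l%:R <= k%:R :> R by rewrite ler_nat.
have : k%:R <= u%:R :> R by rewrite ler_nat.
rewrite !ltr_norml.
(* Half of [eps * n] pays for the deviation at [l] or [u], the other half for the change of the
   mean, at most [u - l <= h]. *)
move=> ? ? ? ? ? ? ? /andP[? ?] /andP[? ?]; apply/andP; split; lra.
Qed.

End CornerSum.

(** * Union bound over the grid and choice of its parameters *)

Lemma leq_card_bigcup (I T : finType) (F : I -> {set T}) :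
  (#|\bigcup_i F i| <= \sum_i #|F i|)%N.
Proof.
elim/big_ind2: _ => [|a A b B Aa Bb|//]; first by rewrite cards0.
exact: leq_trans (leq_card_setU A B).1 (leq_add Aa Bb).
Qed.

Lemma unif_prob_corner_close (R : realType) (n h m : nat) (eps : R) :
  0 < eps -> (1 < n)%N -> (0 < h)%N -> (n.+1 <= m * h)%N ->
  h%:R <= eps / 2 * n%:R ->
  1 - m.+2%:R * 12 / eps ^+ 2 * n%:R^-1 <= unif_prob R (corner_close n eps).
Proof.
move=> eps0 n1 h0 nmh heps.
have n0 : 0 < n%:R :> R by rewrite ltr0n ltnW.
have M0 : 0 < #|'S_n|%:R :> R by rewrite ltr0n card_Sn fact_gt0.
pose A (r : 'I_m.+2) := corner n (minn (r * h) n.+1).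
pose bad r := [set s : 'S_n |
  eps / 2 * n%:R <= `|perm_count (A r) s - #|A r|%:R / n%:R| ]%SET.
(* Chebyshev at [t = eps / 2 * n]: [3 * n / t ^+ 2] equals [12 / (eps ^+ 2 * n)]. *)
have bad_le r : #|bad r|%:R <= 12 / eps ^+ 2 * n%:R^-1 * #|'S_n|%:R :> R.
  have t0 : 0 < eps / 2 * n%:R by rewrite mulr_gt0 ?divr_gt0.
  have := perm_count_chebyshev (A r) n1 (ltW t0).
  rewrite -ler_pdivlMr ?exprn_gt0 // => /le_trans -> //.
  rewrite le_eqVlt; apply/orP; left; apply/eqP; field.
  by rewrite !lt0r_neq0.
have sub : (~: corner_close n eps \subset \bigcup_r bad r)%SET.
  apply/fintype.subsetP => s; rewrite inE; apply: contraR => /bigcupP nbad.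
  apply: (corner_close_grid (ltnW n1) h0 nmh heps) => r.
  rewrite corner_sum_perm ltNge; apply/negP => h1.
  by apply: nbad; exists r => //; rewrite inE.
have : #|(~: corner_close n eps)%SET|%:R
    <= m.+2%:R * (12 / eps ^+ 2 * n%:R^-1 * #|'S_n|%:R) :> R.
  apply: le_trans (_ : (\sum_r #|bad r|)%:R <= _).
    by rewrite ler_nat (leq_trans (subset_leq_card sub)) ?leq_card_bigcup.
  rewrite natr_sum mulr_natl -[m.+2 in leRHS]card_ord -sumr_const.
  exact: ler_sum.
move=> bound; rewrite /unif_prob ler_pdivlMr // mulrBl mul1r lerBlDr.
rewrite -{1}(cardsC (corner_close n eps)) natrD lerD2l (le_trans bound) //.
by rewrite !mulrA.
Qed.

Unset Implicit Arguments.

Theorem theorem5p10 (R : realType) (eps : R) (eps_gt0 : 0 < eps) :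
  exists (C : R) (N0 : nat), 0 < C /\
    forall N : nat, (N0 <= N)%N ->
      unif_prob R (corner_close N eps) >=
        1 - C * (ln N%:R / (N%:R * ln (ln N%:R))).
Proof.
(* The mesh will be [N %/ K], at most [eps / 2 * N] since [K > 2 / eps]; [m = 2 * K] then depends on
   [eps] alone. *)
pose K := Num.Def.archi_bound (2 / eps).
have eK : 2 / eps < K%:R by apply: archi_boundP; rewrite divr_ge0 // ltW.
have K0R : 0 < K%:R :> R by apply: lt_trans eK; rewrite divr_gt0.
have K0 : (0 < K)%N by rewrite -(ltr0n R).
pose C := (2 * K).+2%:R * 12 / eps ^+ 2.
have C0 : 0 < C by rewrite divr_gt0 ?exprn_gt0 // mulr_gt0.
(* The three thresholds serve the variance bound, a nonzero mesh, and [N > e], which makes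
   [ln (ln N)] positive. *)
exists C, (maxn 2 (maxn K (Num.Def.archi_bound (expR 1 : R)))); split=> // N.
rewrite !geq_max => /and3P[N1 KN eN].
have N0 : 0 < N%:R :> R by rewrite ltr0n ltnW.
have lnN : 1 < ln N%:R :> R.
  rewrite -[ltLHS]expRK ltr_ln ?posrE ?expR_gt0 //.
  by apply: lt_le_trans (archi_boundP (expR_ge0 1)) _; rewrite ler_nat.
have lnN0 : 0 < ln N%:R :> R by apply: lt_trans lnN.
have lnlnN : 0 < ln (ln N%:R) :> R by apply: ln_gt0.
have Nh : (N < (N %/ K).+1 * K)%N := ltn_ceil N K0.
have h0 : (0 < N %/ K)%N by rewrite divn_gt0.
(* As [N %/ K >= 1], its successor in [Nh] is at most twice it. *)
have nmh : (N.+1 <= 2 * K * (N %/ K))%N by nia.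
have heps : (N %/ K)%:R <= eps / 2 * N%:R.
  have : (N %/ K * K)%:R <= N%:R :> R by rewrite ler_nat leq_divM.
  rewrite natrM -ler_pdivlMr // => /le_trans -> //.
  by move: eK; rewrite ltr_pdivrMr // ler_pdivrMr //; nra.
apply: le_trans (unif_prob_corner_close eps_gt0 N1 h0 nmh heps).
rewrite lerD2l lerN2 -/C ler_wpM2l ?(ltW C0) //.
(* After clearing denominators, what remains is [ln (ln N) <= ln N]. *)
rewrite ler_pdivlMr ?mulr_gt0 // mulKf ?lt0r_neq0 //.
exact: ltW (ln_sublinear lnN0).
Qed.
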